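(* Let $K$ be a virtual knot diagram. If $\overline{zh}_J(K)=0$ for all sequences $J$ in $\{1,2\}$, then the odd writhe, the Henrich-Turaev polynomial, and the writhe (or affine index) polynomial of $K$ are all trivial (zero).
   Context: Virtual knots. A virtual knot diagram is an oriented generically immersed closed curve in the plane whose double points are marked as classical (over/under) or virtual crossings. Extended group. The short arcs of a diagram $K$ are the paths along $K$ from one classical crossing to the next (virtual crossings are ignored). Write them, in order along $K$ from a base point, as $a_{1},\dots,a_{n}$, indices modulo $n$. The extended group $\widetilde G(K)$ is generated by the short arcs and one further generator $v$, with relations $a_{j+1}=w_j^{-1}a_jw_j$ ($1\le j\le n$), where $w_j=v^{-1}$ if $K$ passes from $a_j$ to $a_{j+1}$ over a positive crossing, $w_j=v$ if over a negative crossing, $w_j=v\,o$ if under a positive crossing, and $w_j=(o\,v)^{-1}$ if under a negative crossing; here $o$ is the short arc of the overcrossing strand entering that crossing. (If there are no classical crossings there is one short arc and no relation.) Extended longitude. Put $l_j=w_1\cdots w_j$ and $\widetilde\lambda=l_n a_1^{k}$, where $k$ is chosen so that the total exponent sum in $\widetilde\lambda$ of the letters $a_1,\dots,a_n$ is $0$ ($\widetilde\lambda=1$ if there are no classical crossings). Let $F$ be the free group on $a,v$. Define homomorphisms $\phi^{(q)}$, $q\ge1$, from the free group on $a_1,\dots,a_n,v$ to $F$ by $\phi^{(q)}(v)=v$, $\phi^{(1)}(a_j)=a$, $\phi^{(q)}(a_1)=a$, and $\phi^{(q+1)}(a_{j+1})=\phi^{(q)}(l_j)^{-1}\,a\,\phi^{(q)}(l_j)$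 for $1\le j\le n-1$. Put $\widetilde\lambda^{(q)}=\phi^{(q)}(\widetilde\lambda)$. Invariants. The Magnus expansion $\epsilon:F\to\mathbb Z[[a,v]]$ (non-commuting power series) is given by $a\mapsto1+a$, $v\mapsto1+v$. For a nonempty sequence $J=j_1\cdots j_s$ in $\{1,2\}$, $\epsilon_J(f)$ is the coefficient in $\epsilon(f)$ of the monomial obtained from $J$ by replacing $1$ by $a$ and $2$ by $v$. For any $q>s$ set $\mu_{J|1}=\epsilon_J(\widetilde\lambda^{(q)})$ (independent of $q>s$) and $\mu_{J|2}=0$, where $J|i$ means $J$ followed by $i$. Let $\Delta_{J|1}$ be the greatest common divisor of all $\mu_{I}$ where $I$ ranges over sequences of length at least 2 obtained from $J|1$ by deleting one or more terms and cyclically permuting the remaining ones (with $\Delta=0$ if there are none or all are $0$). Then $\overline{zh}_J(K)$ is the residue class of $\mu_{J|1}$ modulo $\Delta_{J|1}$. Index invariants (standard definitions). For a classical crossing $c$ of $K$ with sign $\operatorname{sgn}(c)$, travel along $K$ from the overcrossing point of $c$ to its undercrossing point, and let $\operatorname{ind}(c)$ be the sum, over all passages through classical crossings $d$ strictly in between, of $+\operatorname{sgn}(d)$ for an overpassage and $-\operatorname{sgn}(d)$ for an underpassage. The odd writhe is $\sum_{\operatorname{ind}(c)\text{ odd}}\operatorname{sgn}(c)$. The writhe polynomial is $\sum_{\operatorname{ind}(c)\ne0}\operatorname{sgn}(c)\,t^{\operatorname{ind}(c)}$, which carries the same information as the affine index polynomial $\sum_c\operatorname{sgn}(c)(t^{\operatorname{ind}(c)}-1)$.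 The Henrich-Turaev polynomial is $\sum_{\operatorname{ind}(c)\ne0}\operatorname{sgn}(c)\,t^{|\operatorname{ind}(c)|}$. *)

(* Defs.v *)
From HB Require Import structures.
From mathcomp Require Import all_boot all_order all_algebra.
From mathcomp Require Import all_classical all_reals all_analysis.
Set Implicit Arguments.
Unset Strict Implicit.
Unset Printing Implicit Defensive.
Import Order.TTheory GRing.Theory Num.Theory.
Import numFieldNormedType.Exports.
Local Open Scope ring_scope.

(* How a double point [(s, t)] with [s < t] is marked: virtual, or classical
   with the passage at parameter [s] (resp. [t]) on the over-strand. *)
Variant marking := Virtual | FirstOver | SecondOver.

(* An oriented closed curve in the plane is a 1-periodic map t |-> (x t, y t),
   oriented by increasing t; its base point is the point of parameter 0.
   Being generically immersed: C^1 with nowhere vanishing velocity, finitely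
   many multiple points, all of them transverse double points.  Only the values
   of [vd_mark] on [vd_double] are meaningful. *)
Record vdiagram (R : realType) := VDiagram {
  vd_x : R -> R;
  vd_y : R -> R;
  vd_double : seq (R * R);
  vd_mark : R * R -> marking;
  vd_periodic : forall t, vd_x (t + 1) = vd_x t /\ vd_y (t + 1) = vd_y t;
  vd_derivable : forall t, derivable vd_x t 1 /\ derivable vd_y t 1;
  vd_C1 : continuous (derive1 vd_x) /\ continuous (derive1 vd_y);
  vd_immersion : forall t, (derive1 vd_x t, derive1 vd_y t) <> (0, 0);
  vd_double_uniq : uniq vd_double;
  vd_doubleP : forall s t, (s, t) \in vd_double <->
    [/\ 0 <= s, s < t, t < 1, vd_x s = vd_x t & vd_y s = vd_y t];
  vd_no_triple : forall r s t, 0 <= r -> r < s -> s < t -> t < 1 ->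
    (r, s) \in vd_double -> (s, t) \notin vd_double;
  vd_transverse : forall s t, (s, t) \in vd_double ->
    derive1 vd_x s * derive1 vd_y t - derive1 vd_y s * derive1 vd_x t != 0
}.

Section Diagram.
Variables (R : realType) (K : vdiagram R).
Implicit Type c : R * R.

Definition classical : seq (R * R) :=
  [seq c <- vd_double K | if vd_mark K c is Virtual then false else true].

Definition over_time c : R := if vd_mark K c is FirstOver then c.1 else c.2.
Definition under_time c : R := if vd_mark K c is FirstOver then c.2 else c.1.

(* A crossing is positive when (velocity of the over-strand, velocity of the
   under-strand) is a positively oriented basis of the plane. *)
Definition csign c : int :=
  let o := over_time c in let u := under_time c in
  sgz (derive1 (vd_x K) o * derive1 (vd_y K) u -
       derive1 (vd_y K) o * derive1 (vd_x K) u).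

(* [(c, true)] is the overpassage and [(c, false)] the underpassage at the
   crossing [c]. *)
Definition passage : eqType := ((R * R) * bool)%type.

Definition ptime (p : passage) : R :=
  if p.2 then over_time p.1 else under_time p.1.

Definition passages : seq passage :=
  sort (fun p q => ptime p <= ptime q)
    ([seq (c, true) | c <- classical] ++ [seq (c, false) | c <- classical]).

End Diagram.

(* Elements of the free group on [X] are represented by words, [(x, true)]
   standing for x and [(x, false)] for x^-1.  Words need not be reduced: what
   is computed from them below is invariant under free reduction
   (see [magnus_cancel]). *)
Definition word (X : Type) := seq (X * bool).

Definition winv (X : Type) (w : word X) : word X :=
  rev [seq (l.1, ~~ l.2) | l <- w].

Definition wpow (X : Type) (x : X) (k : int) : word X :=
  nseq `|k|%N (x, 0 <= k).

(* The homomorphism extending a map on generators. *)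
Definition whom (X Y : Type) (f : X -> word Y) (w : word X) : word Y :=
  flatten [seq if l.2 then f l.1 else winv (f l.1) | l <- w].

(* The generators of F, and at the same time the indices 1 and 2. *)
Definition gen : eqType := bool.
Definition ga : gen := true.
Definition gv : gen := false.

(* Generators of the extended group: [Some j] is the short arc a_(j+1) (arcs
   are numbered from 0), [None] is v. *)
Definition egen := option nat.

Section ExtendedLongitude.
Variables (R : realType) (K : vdiagram R).

(* The arc number j ends at the passage number j; hence [o] below is the arc
   of the over-strand entering the crossing.  The default value of [nth] is
   irrelevant, as w_j is used for [j < size (passages K)] only. *)
Definition wgen (j : nat) : word egen :=
  let p := nth ((0, 0), true) (passages K) j in
  let v : egen := None in
  let o : egen := Some (index (p.1, true) (passages K)) in
  let positive := 0 < csign K p.1 in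
  match p.2, positive with
  | true, true => [:: (v, false)]
  | true, false => [:: (v, true)]
  | false, true => [:: (v, true); (o, true)]
  | false, false => winv [:: (o, true); (v, true)]
  end.

(* w_1 ... w_j *)
Definition lword (j : nat) : word egen :=
  flatten [seq wgen i | i <- iota 0 j].

Definition arc_exponent (w : word egen) : int :=
  \sum_(l <- w) (if l.1 is Some _ then if l.2 then 1 else -1 else 0).

Definition longitude : word egen :=
  let l := lword (size (passages K)) in
  l ++ wpow (Some 0%N) (- arc_exponent l).

(* phi^(q) on generators, for q >= 1 (the value at q = 0 is a dummy); since
   l_0 is empty, phi^(q) (a_1) = a. *)
Fixpoint phi (q : nat) (x : egen) : word gen :=
  match x with
  | None => [:: (gv, true)]
  | Some j =>
    match q with
    | 0 | 1 => [:: (ga, true)]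
    | r.+1 => let l := whom (phi r) (lword j) in
              winv l ++ [:: (ga, true)] ++ l
    end
  end.

Definition longitude_ (q : nat) : word gen := whom (phi q) longitude.

End ExtendedLongitude.

(* Z[[a, v]]: a non-commuting power series is the family of its coefficients,
   indexed by monomials. *)
Definition ncseries := seq gen -> int.

Definition ncone : ncseries := fun J => (J == [::])%:R.

Definition ncmul (f g : ncseries) : ncseries := fun J =>
  \sum_(i < (size J).+1) f (take i J) * g (drop i J).

(* 1 + x, and its inverse, the sum of the (-1)^k x^k. *)
Definition magnus_letter (l : gen * bool) : ncseries := fun J =>
  if l.2 then (J == [::])%:R + (J == [:: l.1])%:R
  else if all (pred1 l.1) J then (-1) ^+ size J else 0.

Definition magnus (w : word gen) : ncseries :=
  foldr (fun l f => ncmul (magnus_letter l) f) ncone w.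

Lemma ncmul_cons (f g : ncseries) x J :
  ncmul f g (x :: J) = f [::] * g (x :: J) + ncmul (fun I => f (x :: I)) g J.
Proof. by rewrite /ncmul big_ord_recl. Qed.

Lemma eq_ncmul f f' g g' : f =1 f' -> g =1 g' -> ncmul f g =1 ncmul f' g'.
Proof. by move=> ef eg J; apply: eq_bigr => i _; rewrite ef eg. Qed.

Lemma magnus_letter_mul x g :
  (ncmul (magnus_letter (x, true)) g =1 fun J =>
    g J + (if J is y :: J1 then if y == x then g J1 else 0 else 0)).
Proof.
case=> [|y J]; first by rewrite /ncmul big_ord1 /magnus_letter /= mul1r addr0.
rewrite ncmul_cons /magnus_letter /= mul1r; congr (_ + _).
rewrite /ncmul big_ord_recl /= big1 ?addr0 => [|i _]; last first.
  by case: J i => [[]|z J i] //=; rewrite eqseq_cons andbF mul0r.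
by rewrite take0 drop0 eqseq_cons eqxx andbT; case: eqP; rewrite ?mul1r ?mul0r.
Qed.

Lemma magnus_letter_inv_cons x g y J :
  ncmul (magnus_letter (x, false)) g (y :: J) = g (y :: J) -
    (if y == x then ncmul (magnus_letter (x, false)) g J else 0).
Proof.
rewrite ncmul_cons /magnus_letter /= mul1r; congr (_ + _).
have [_|_] := eqVneq y x; rewrite /ncmul.
  rewrite -sumrN; apply: eq_bigr => i _ /=.
  by case: ifP => _; rewrite ?exprS ?mulN1r ?mulNr ?mul0r ?oppr0.
by rewrite oppr0 big1 // => i _; rewrite /= mul0r.
Qed.

Lemma magnus_letterK x b g :
  ncmul (magnus_letter (x, b)) (ncmul (magnus_letter (x, ~~ b)) g) =1 g.
Proof.
have inv0 h : ncmul (magnus_letter (x, false)) h [::] = h [::].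
  by rewrite /ncmul big_ord1 /magnus_letter /= mul1r.
case: b => /= J.
  rewrite magnus_letter_mul; case: J => [|y J]; first by rewrite inv0 addr0.
  by rewrite magnus_letter_inv_cons subrK.
elim: J => [|y J IH]; first by rewrite inv0 magnus_letter_mul addr0.
by rewrite magnus_letter_inv_cons IH magnus_letter_mul addrK.
Qed.

Lemma magnus_cancel u w x b :
  magnus (u ++ [:: (x, b), (x, ~~ b) & w]) =1 magnus (u ++ w).
Proof.
elim: u => [|l u IH] /=; first exact: magnus_letterK.
by apply: eq_ncmul.
Qed.

Section Invariants.
Variables (R : realType) (K : vdiagram R).

(* mu_(J|i), with q = s + 1 where s is the length of J. *)
Definition mu (J : seq gen) (i : gen) : int :=
  if i == ga then magnus (longitude_ K (size J).+1) J else 0.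

Definition mu_seq (I : seq gen) : int :=
  if I is x :: I' then mu (belast x I') (last x I') else 0.

(* The gcd of the mu_I, with I a rotation of a subsequence [mask m S] of
   length at least 2 and smaller than the length of S = J|1; [gcdz] being
   nonnegative with [gcdz 0 0 = 0], an empty gcd or a gcd of zeros is 0. *)
Definition Delta (J : seq gen) : int :=
  let S := rcons J ga in
  \big[gcdz/0]_(m : (size S).-tuple bool | (2 <= size (mask m S) < size S)%N)
    \big[gcdz/0]_(r < size (mask m S)) mu_seq (rot r (mask m S)).

(* The canonical representative of the residue class of mu_(J|1) modulo Delta;
   as [(m %% 0)%Z = m], the class is an integer when Delta is 0. *)
Definition zh (J : seq gen) : int := (mu J ga %% Delta J)%Z.

(* The passage at parameter r is met strictly between those at parameters
   s and t when travelling along K from s to t (s and t distinct in [0, 1)). *)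
Definition between (s t r : R) : bool :=
  if s < t then s < r < t else (s < r) || (r < t).

Definition ind (c : R * R) : int :=
  \sum_(d <- passages K | between (over_time K c) (under_time K c) (ptime K d))
    (if d.2 then csign K d.1 else - csign K d.1).

Definition odd_writhe : int :=
  \sum_(c <- classical K | odd `|ind c|%N) csign K c.

(* Laurent polynomials over Z live in the field Z(t), with t = [tvar]. *)
Definition tvar : {fraction {poly int}} := tofrac 'X.

Definition writhe_poly : {fraction {poly int}} :=
  \sum_(c <- classical K | ind c != 0) (csign K c)%:~R * tvar ^ ind c.

Definition affine_index_poly : {fraction {poly int}} :=
  \sum_(c <- classical K) (csign K c)%:~R * (tvar ^ ind c - 1).

Definition henrich_turaev_poly : {poly int} :=
  \sum_(c <- classical K | ind c != 0) csign K c *: 'X^`|ind c|%N.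

End Invariants.

(* Main.v *)
Require Import Defs.
From mathcomp Require Import all_boot all_order all_algebra.
From mathcomp Require Import all_classical all_reals all_analysis.
From mathcomp Require Import ring lra zify.
Import Order.TTheory GRing.Theory Num.Theory.
Local Open Scope ring_scope.

(** Every invariant in the conclusion has the form [\sum_c sgn(c) * g(ind c)]
    with [g 0 = 0], so it suffices that the signs of the crossings of any given
    nonzero index add up to zero ([moments_fiber]).  This is read off the
    longitude as follows.

    By induction on the length of J, all [mu_(J|1)] vanish: the gcd defining
    the residue class of J only involves sequences shorter than [J|1], so it is
    zero and the class is the integer itself ([mu_eq0_of_zh]).

    Only the monomials a v^j are needed.  As [v |-> 1 + v], the coefficient of
    v^j in the expansion of a word w is the binomial coefficient C(e, j), with
    e the exponent sum of v in w ([magnus_v]).  The coefficient of a v^j is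
    therefore a Fox derivative: each letter a^(+-1) of w contributes +-C(e, j),
    where e is the exponent sum of v to its right ([magnus_av]).

    A short arc is sent to a conjugate l^-1 a l, and the derivative of such a
    word depends on the exponent sum of v in l only, which is the same for all
    phi^(q).  In the longitude the letters a come from the underpassages, one
    for each crossing c with the sign of c, and from the final power of a_1.
    The exponent sum of v along K is, up to sign, the height function adding up
    the contributions of the passages to the index; at the letter given by c
    the heights of the two passages of c combine to exactly ind(c)
    ([fox_longitude]).  The final power of a_1 contributes multiples of
    C(0, j) = 0 for j > 0.

    So [\sum_c sgn(c) C(ind c, j) = 0] for all j > 0.  Over the rationals the
    binomial polynomials of positive degree span the polynomials vanishing at 0,
    and a polynomial which vanishes at 0 and at all the indices except k <> 0
    isolates the crossings of index k. *)

(** * Binomial coefficients with an integer upper argument *)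

Definition binz (e : int) (j : nat) : rat :=
  \prod_(i < j) (e%:~R - i%:R) / j`!%:R.

Lemma binz0 e : binz e 0 = 1.
Proof. by rewrite /binz big_ord0 fact0 divr1. Qed.

Lemma binz0S j : binz 0 j.+1 = 0.
Proof. by rewrite /binz big_ord_recl subrr !mul0r. Qed.

Lemma binzS e j : j.+1%:R * binz e j.+1 = (e%:~R - j%:R) * binz e j.
Proof.
rewrite /binz big_ord_recr /= factS natrM.
have nz k : k.+1%:R != 0 :> rat by rewrite pnatr_eq0.
have nf : j`!%:R != 0 :> rat by rewrite pnatr_eq0 -lt0n fact_gt0.
by field; rewrite nf nat1r nz.
Qed.

Lemma binz_pascal e j : binz (e + 1) j.+1 = binz e j.+1 + binz e j.
Proof.
have nz k : k.+1%:R != 0 :> rat by rewrite pnatr_eq0.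
elim: j => [|j IH].
  by apply: (mulfI (nz 0%N)); rewrite mulrDr !binzS !binz0 rmorphD /=; ring.
apply: (mulfI (nz j.+1)); rewrite mulrDr !binzS IH rmorphD /=.
have := binzS e j; rewrite -!natr1 => E.
have -> : (e%:~R + 1%:~R - (j%:R + 1)) * (binz e j.+1 + binz e j) =
  (e%:~R - j%:R) * binz e j.+1 + (e%:~R - j%:R) * binz e j by ring.
by rewrite -E; ring.
Qed.

(** * Magnus coefficients of a v^j as Fox derivatives *)

Definition sgb (b : bool) : int := if b then 1 else -1.

Definition vexp (w : word gen) : int :=
  \sum_(l <- w) (if l.1 == gv then sgb l.2 else 0).

(** [h] stands for a linear functional on Z[V, V^-1], given by its values on
    the powers of V: [fox h w] is its value on the Fox derivative dw/da after
    a |-> 1, v |-> V.  Keeping [h] arbitrary turns the product rule into a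
    translation of [h]. *)
Fixpoint fox {V : zmodType} (h : int -> V) (w : word gen) : V :=
  if w is l :: w' then
    (if l.1 == ga then h (vexp w') *~ sgb l.2 else 0) + fox h w'
  else 0.

Lemma fox_cons (V : zmodType) (h : int -> V) l w :
  fox h (l :: w) =
  (if l.1 == ga then h (vexp w) *~ sgb l.2 else 0) + fox h w.
Proof. by []. Qed.

Lemma vexp_nil : vexp [::] = 0.
Proof. by rewrite /vexp big_nil. Qed.

Lemma vexp_cons l w :
  vexp (l :: w) = (if l.1 == gv then sgb l.2 else 0) + vexp w.
Proof. by rewrite /vexp big_cons. Qed.

Lemma vexp_cat u w : vexp (u ++ w) = vexp u + vexp w.
Proof. by rewrite /vexp big_cat. Qed.

Lemma vexp_winv w : vexp (winv w) = - vexp w.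
Proof.
rewrite /vexp /winv big_rev big_map -sumrN; apply: eq_bigr => -[x b] _ /=.
by case: ifP; case: b; rewrite ?oppr0 ?opprK.
Qed.

Lemma ncmul_nil (f g : ncseries) : ncmul f g [::] = f [::] * g [::].
Proof. by rewrite /ncmul big_ord1. Qed.

Lemma letter_nil l : magnus_letter l [::] = 1.
Proof. by case: l => x [] //=; rewrite /magnus_letter /= addr0. Qed.

Lemma magnus_nil w : magnus w [::] = 1.
Proof. by elim: w => [|l w IH] //=; rewrite ncmul_nil letter_nil IH. Qed.

Lemma magnus_pos x w y J :
  magnus ((x, true) :: w) (y :: J) =
  magnus w (y :: J) + (if y == x then magnus w J else 0).
Proof. exact: magnus_letter_mul. Qed.

Lemma magnus_neg x w y J :
  magnus ((x, false) :: w) (y :: J) =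
  magnus w (y :: J) - (if y == x then magnus ((x, false) :: w) J else 0).
Proof. exact: magnus_letter_inv_cons. Qed.

Lemma magnus_cons_neq l w y J :
  y != l.1 -> magnus (l :: w) (y :: J) = magnus w (y :: J).
Proof.
case: l => x [] /negPf yx; first by rewrite magnus_pos yx addr0.
by rewrite magnus_neg yx subr0.
Qed.

(** The expansion of w with a = 0 is (1 + v)^(vexp w). *)
Lemma magnus_v w j : (magnus w (nseq j gv))%:~R = binz (vexp w) j.
Proof.
have nseqS k : nseq k.+1 gv = gv :: nseq k gv by [].
elim: w j => [|[x b] w IH] j.
  by rewrite vexp_nil; case: j => [|j]; rewrite ?binz0 ?binz0S.
case: j => [|j]; first by rewrite magnus_nil binz0.
have [->|xv] := eqVneq x gv; last first.
  rewrite nseqS magnus_cons_neq 1?eq_sym // -nseqS IH.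
  by rewrite vexp_cons (negPf xv) add0r.
rewrite vexp_cons eqxx; case: b.
  by rewrite nseqS magnus_pos eqxx -nseqS intrD !IH [sgb _ + _]addrC binz_pascal.
elim: j => [|j IHj]; rewrite nseqS magnus_neg eqxx -nseqS intrB ?IHj IH.
  rewrite !magnus_nil -[in LHS](subrK 1 (vexp w)) binz_pascal binz0 addrK.
  by rewrite addrC.
rewrite -[X in binz X _ - _](subrK 1 (vexp w)) binz_pascal [_ + vexp w]addrC.
by rewrite addrK.
Qed.

(** A monomial a v^j of a product arises either from the tail alone, or from the
    letter a of the head and v^j of the tail; for a^-1 the powers of a beyond
    the first cannot occur in a v^j. *)
Lemma magnus_av w j :
  (magnus w (ga :: nseq j gv))%:~R = fox (fun e => binz e j) w.
Proof.
elim: w => [|[x b] w IH] //.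
rewrite fox_cons -IH -magnus_v; have [->|xa] := eqVneq x ga; last first.
  by rewrite add0r magnus_cons_neq 1?eq_sym.
case: b.
  by rewrite magnus_pos eqxx intrD addrC.
rewrite magnus_neg eqxx intrB addrC mulrN1z; congr (- _%:~R + _).
case: j {IH} => [|j]; first by rewrite !magnus_nil.
by rewrite magnus_cons_neq.
Qed.

Section Fox.
Variable V : zmodType.
Implicit Type h : int -> V.

Lemma eq_fox h h' w : h =1 h' -> fox h w = fox h' w.
Proof. by move=> eh; elim: w => //= l w ->; rewrite eh. Qed.

(** Product rule: a letter of u also sees the letters v of w on its right. *)
Lemma fox_cat h u w :
  fox h (u ++ w) = fox (fun e => h (e + vexp w)) u + fox h w.
Proof.
by elim: u => [|l u IH] /=; rewrite ?add0r // IH vexp_cat addrA.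
Qed.

Lemma winv_cons (X : Type) l (w : word X) :
  winv (l :: w) = winv w ++ [:: (l.1, ~~ l.2)].
Proof. by rewrite /winv /= rev_cons -cats1. Qed.

Lemma fox_winv h w : fox h (winv w) = - fox (fun e => h (e - vexp w)) w.
Proof.
elim: w h => [|[x b] w IH] h; first by rewrite oppr0.
rewrite winv_cons fox_cat IH /= !vexp_cons vexp_nil addr0 opprD addrC /=.
congr (_ + _); last first.
  congr (- _); apply: eq_fox => e; congr h.
  by case: ifP; case: b; rewrite /sgb /=; lia.
rewrite addr0; case: eqP => [->|_]; last by rewrite oppr0.
by rewrite add0r subrr; case: b; rewrite /sgb ?mulrN1z ?opprK.
Qed.

(** The contributions of l and of its inverse cancel, since conjugating a does
    not change the exponent sum of v: this is why the arcs enter the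
    computation through exponent sums only. *)
Lemma fox_conj_a h l : fox h (winv l ++ (ga, true) :: l) = h (vexp l).
Proof.
rewrite fox_cat fox_winv /= vexp_cons /= add0r mulr1z.
rewrite (@eq_fox _ h) => [|e]; first by rewrite addrC addrK.
by rewrite subrK.
Qed.
End Fox.

Lemma whom_cat (X Y : Type) (f : X -> word Y) u w :
  whom f (u ++ w) = whom f u ++ whom f w.
Proof. by rewrite /whom map_cat flatten_cat. Qed.

(** * From binomial moments to fibres *)

(** [sg c] and [e c] are to be the sign and the index of a crossing c. *)
Section Moments.
Variables (T : eqType) (s : seq T) (sg e : T -> int).
Hypothesis moments : forall j,
  \sum_(c <- s) binz (e c) j.+1 *~ sg c = 0.

(** The polynomials annihilated by the moments are stable under multiplication
    by x - r, because
    (x - r) C(x, j) = (j + 1) C(x, j + 1) + (j - r) C(x, j). *)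
Lemma moments_prod (rs : seq int) j :
  \sum_(c <- s) (binz (e c) j.+1 * \prod_(r <- rs) (e c - r)%:~R) *~ sg c = 0.
Proof.
elim: rs j => [|r rs IH] j.
  by under eq_bigr do rewrite big_nil mulr1; exact: moments.
transitivity (j.+2%:R * \sum_(c <- s)
    (binz (e c) j.+2 * \prod_(r <- rs) (e c - r)%:~R) *~ sg c +
  (j.+1%:R - r%:~R) * \sum_(c <- s)
    (binz (e c) j.+1 * \prod_(r <- rs) (e c - r)%:~R) *~ sg c); last first.
  by rewrite !IH !mulr0 addr0.
rewrite !mulr_sumr -big_split; apply: eq_bigr => c _ /=.
rewrite big_cons rmorphB /= (mulrzAr _ j.+2%:R) (mulrzAr _ (_ - _)) -mulrzDl.
congr (_ *~ _).
by rewrite (mulrA j.+2%:R) binzS; ring.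
Qed.

(** The polynomial x * \prod_r (x - r), with r ranging over the values of e
    other than k, vanishes at all values of e except k. *)
Lemma moments_fiber k : k != 0 -> \sum_(c <- s | e c == k) sg c = 0.
Proof.
move=> k0; pose rs := [seq r <- map e s | r != k].
pose x : rat := k%:~R * \prod_(r <- rs) (k - r)%:~R.
have x0 : x != 0.
  rewrite mulf_neq0 ?intr_eq0 // prodf_seq_neq0; apply/allP => r.
  by rewrite mem_filter intr_eq0 subr_eq0 eq_sym => /andP[].
have := moments_prod rs 0.
have -> : \sum_(c <- s)
    (binz (e c) 1 * \prod_(r <- rs) (e c - r)%:~R) *~ sg c =
  x * (\sum_(c <- s | e c == k) sg c)%:~R.
  rewrite rmorph_sum mulr_sumr [RHS]big_mkcond.
  apply: eq_big_seq => c cs; have [ck|ck] /= := eqVneq (e c) k.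
    rewrite ck; have := binzS k 0; rewrite mul1r binz0 subr0 mulr1 => ->.
    by rewrite -mulrzr.
  rewrite (big_rem (e c)) /= ?subrr ?mul0r ?mulr0 ?mul0rz //.
  by rewrite mem_filter ck map_f.
by move=> /eqP; rewrite mulf_eq0 (negPf x0) intr_eq0 => /eqP.
Qed.

Lemma moments_fun (V : zmodType) (g : int -> V) :
  g 0 = 0 -> \sum_(c <- s) g (e c) *~ sg c = 0.
Proof.
move=> g0.
transitivity (\sum_(k <- undup (map e s)) \sum_(c <- s | e c == k) g k *~ sg c).
  rewrite (exchange_big_dep predT) //=; apply: eq_big_seq => c cs.
  rewrite -big_filter (eq_filter (a2 := pred1 (e c))) => [|k]; last exact: eq_sym.
  by rewrite filter_pred1_uniq ?big_seq1 ?undup_uniq // mem_undup map_f.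
rewrite big1 // => k _; rewrite -mulrz_sumr.
by have [->|/moments_fiber ->] := eqVneq k 0; rewrite ?g0 ?mul0rz.
Qed.
End Moments.

(** * Vanishing of the residue classes implies vanishing of the mu *)

Lemma big_gcdz_eq0 (I : Type) (r : seq I) (P : pred I) (F : I -> int) :
  (forall i, P i -> F i = 0) -> \big[gcdz/0]_(i <- r | P i) F i = 0.
Proof. by move=> F0; elim/big_ind: _ => // x y -> ->. Qed.

Section MuOfZh.
Variables (R : realType) (K : vdiagram R).
Hypothesis zh_eq0 : forall J : seq gen, J <> [::] -> zh K J = 0.

Lemma mu_eq0_of_zh J : J <> [::] -> mu K J ga = 0.
Proof.
have [n] := ubnP (size J); elim: n J => // n IH J; rewrite ltnS => Jn Jnil.
have := zh_eq0 J Jnil; rewrite /zh.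
suff -> : Delta K J = 0 by rewrite modz0.
apply: big_gcdz_eq0 => m /andP[m2 mS]; apply: big_gcdz_eq0 => r _.
set I := rot _ _.
have sI : (2 <= size I < (size J).+1)%N.
  by rewrite size_rot m2 -(size_rcons J ga).
case: I sI => [|x [|y I]] // /andP[_]; rewrite /= ltnS => IJ.
rewrite /mu_seq /=; case: (last y I =P ga) => [->|/eqP l]; last first.
  by rewrite /mu (negPf l).
by apply: IH => //=; rewrite size_belast; exact: leq_trans Jn.
Qed.
End MuOfZh.

(** * The index as a difference of heights *)

(** Indicator of a cyclic interval as a combination of indicators of initial
    segments.  When u < o the interval wraps around, which costs one full
    turn: the last term on the left. *)
Lemma between_cut (R : realType) (o u r : R) (x : int) : o != u ->
  (if between o u r then x else 0) + (if o < u then 0 else - x) =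
  (if r < u then x else 0) + (if r < o then - x else 0)
    + (if r == o then - x else 0).
Proof.
rewrite /between; case: (ltgtP o u) => // ou _;
  case: (ltgtP r o) => ro; case: (ltgtP r u) => ru /=;
  rewrite ?addr0 ?add0r ?addrN ?addNr ?oppr0 //; exfalso; lra.
Qed.

Section Passages.
Variables (R : realType) (K : vdiagram R).
Implicit Types (c d : R * R) (p q : passage R).

Notation P := (passages K).
Let p0 : passage R := ((0, 0), true).

Lemma classical_double c : c \in classical K -> c \in vd_double K.
Proof. by rewrite mem_filter => /andP[]. Qed.

Lemma double_lt c : c \in vd_double K -> c.1 < c.2.
Proof. by case: c => s t /vd_doubleP[]. Qed.

(** A parameter common to two different double points would give a triple point. *)
Lemma double_disjoint c d t :
  c \in vd_double K -> d \in vd_double K ->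
  t \in [:: c.1; c.2] -> t \in [:: d.1; d.2] -> c = d.
Proof.
case: c d => [a b] [a' b'] cD dD; rewrite !inE /=.
have /vd_doubleP[a0 ab b1 xab yab] := cD.
have /vd_doubleP[a'0 ab' b'1 xab' yab'] := dD.
move=> /orP[] /eqP-> /orP[] /eqP e; subst.
- case: (ltgtP b b') => [bb'|bb'|-> //].
    have : (b, b') \in vd_double K.
      by apply/vd_doubleP; split; rewrite -?xab -?yab //; lra.
    by apply/contraTeq => _; apply: (vd_no_triple a'0 ab bb').
  have : (b', b) \in vd_double K.
    by apply/vd_doubleP; split; rewrite -?xab' -?yab' //; lra.
  by apply/contraTeq => _; apply: (vd_no_triple a'0 ab' bb').
- by have := vd_no_triple a'0 ab' ab b1 dD; rewrite cD.
- by have := vd_no_triple a0 ab ab' b'1 cD; rewrite dD.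
- case: (ltgtP a a') => [aa'|aa'|-> //].
    have : (a, a') \in vd_double K.
      by apply/vd_doubleP; split; rewrite ?xab ?yab //; lra.
    move=> aD; have := vd_no_triple a0 aa' ab' b'1 aD.
    by rewrite dD.
  have : (a', a) \in vd_double K.
    by apply/vd_doubleP; split; rewrite ?xab' ?yab' //; lra.
  move=> aD; have := vd_no_triple a'0 aa' ab b'1 aD.
  by rewrite cD.
Qed.

Lemma mem_passages p : (p \in P) = (p.1 \in classical K).
Proof.
rewrite mem_sort mem_cat; case: p => c b; apply/orP/idP => /=.
  by case=> /mapP[d dK [-> _]].
by case: b => cK; [left|right]; apply/mapP; exists c.
Qed.

Lemma big_passages (V : nmodType) (G : passage R -> V) :
  \sum_(p <- P) G p = \sum_(c <- classical K) (G (c, true) + G (c, false)).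
Proof.
rewrite big_split /passages (perm_big _ (permEl (perm_sort _ _))) big_cat /=.
by rewrite !big_map.
Qed.

Lemma ptime_mem p : ptime K p \in [:: p.1.1; p.1.2].
Proof.
rewrite /ptime /over_time /under_time !inE.
by case: p.2; case: vd_mark; rewrite eqxx ?orbT.
Qed.

Lemma over_under c : c \in vd_double K -> over_time K c != under_time K c.
Proof.
move=> /double_lt; rewrite /over_time /under_time lt_neqAle => /andP[n _].
by case: vd_mark; rewrite // eq_sym.
Qed.

Lemma ptime_inj : {in P &, injective (ptime K)}.
Proof.
move=> [c b] [d b']; rewrite !mem_passages => /= cK dK e.
have ecd : c = d.
  apply: (double_disjoint c d (ptime K (c, b))); rewrite ?classical_double //.
    exact: (ptime_mem (c, b)).
  by rewrite e; exact: (ptime_mem (d, b')).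
rewrite -ecd in e *; congr (_, _); have := over_under _ (classical_double _ cK).
by case: b b' e => [] [] // ; rewrite /ptime /= => ->; rewrite eqxx.
Qed.

Lemma passages_uniq : uniq P.
Proof.
have u : uniq (classical K) by rewrite filter_uniq // vd_double_uniq.
rewrite sort_uniq cat_uniq !map_inj_uniq ?u ?andbT => [|c d []|c d []] //=.
by apply/hasPn => _ /mapP[c _ ->]; apply/mapP => -[].
Qed.

Lemma ptime_sorted i j : (i < size P)%N -> (j < size P)%N ->
  (ptime K (nth p0 P i) < ptime K (nth p0 P j)) = (i < j)%N.
Proof.
move=> iP jP; rewrite -!(nth_map p0 0) //.
apply: lt_sorted_ltn_nth; rewrite ?inE ?size_map // lt_sorted_uniq_le.
rewrite map_inj_in_uniq ?passages_uniq /=; last exact: ptime_inj.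
rewrite sorted_map; apply: sort_sorted => p q; exact: le_total.
Qed.

(** The contribution of a passage to an index; it is minus the exponent of v in
    the corresponding w_j. *)
Definition contrib p : int := if p.2 then csign K p.1 else - csign K p.1.

Definition height (t : R) : int := \sum_(p <- P | ptime K p < t) contrib p.

(** The two passages of a crossing contribute opposite amounts. *)
Lemma contrib_total : \sum_(p <- P) contrib p = 0.
Proof. by rewrite big_passages big1 // => c _; rewrite /contrib /= subrr. Qed.

Lemma height_nth j : (j < size P)%N ->
  height (ptime K (nth p0 P j)) = \sum_(0 <= i < j) contrib (nth p0 P i).
Proof.
move=> jP; rewrite /height (big_nth p0) (big_nat_widen _ _ _ _ _ (ltnW jP)) /=.
rewrite big_nat_cond [RHS]big_nat_cond; apply: eq_bigl => i.
by rewrite /=; case: (boolP (i < size P)%N) => //= iP; rewrite ptime_sorted.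
Qed.

(** As a full turn contributes nothing, the sum from the overpassage to the
    underpassage is a difference of heights even when it passes the base
    point. *)
Lemma ind_height c : c \in classical K ->
  ind K c = height (under_time K c) - height (over_time K c) - csign K c.
Proof.
move=> cK; set o := over_time K c; set u := under_time K c.
have contrib_over : \sum_(p <- P | ptime K p == o) contrib p = csign K c.
  have cP : (c, true) \in P by rewrite mem_passages.
  rewrite big_seq_cond (eq_bigl (fun p => (p \in P) && (p == (c, true)))) => [|p].
    by rewrite -big_seq_cond -big_filter filter_pred1_uniq ?big_seq1 ?passages_uniq.
  case: (boolP (p \in P)) => //= pP; apply/eqP/eqP => [|-> //].
  exact: (ptime_inj p (c, true) pP cP).
rewrite -contrib_over /ind /height -/o -/u.
have -> : \sum_(d <- P | between o u (ptime K d))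
    (if d.2 then csign K d.1 else - csign K d.1) =
  \sum_(d <- P | between o u (ptime K d)) contrib d
    + (if o < u then 0 else - \sum_(d <- P) contrib d).
  by rewrite contrib_total oppr0 if_same addr0.
have ou : o != u by rewrite over_under ?classical_double.
rewrite -!sumrN big_mkcond [\sum_(p <- P | _ < u) _]big_mkcond.
rewrite [\sum_(p <- P | _ < o) _]big_mkcond [\sum_(p <- P | _ == o) _]big_mkcond.
rewrite -!big_split /=.
have -> (V : nmodType) (b : bool) (r : seq (passage R)) (F : passage R -> V) :
    (if b then 0 else \sum_(p <- r) F p) =
    \sum_(p <- r) (if b then 0 else F p).
  by case: b; rewrite // big1.
by rewrite -big_split; apply: eq_bigr => p _; rewrite /= between_cut.
Qed.

(** Transversality makes the sign nonzero. *)
Lemma csign_sgb c : c \in classical K -> csign K c = sgb (0 < csign K c).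
Proof.
move=> cK; have /vd_transverse : (c.1, c.2) \in vd_double K.
  by rewrite -surjective_pairing classical_double.
rewrite /csign /over_time /under_time; set x := (X in sgz X) => /= nz.
have x0 : x != 0.
  by rewrite {}/x; case: vd_mark; rewrite // -oppr_eq0 opprB mulrC
    [X in _ - X]mulrC.
by case: sgzP x0.
Qed.
End Passages.

(** * The Fox derivative of the longitude *)

Section Longitude.
Variables (R : realType) (K : vdiagram R).
Notation P := (passages K).
Let p0 : passage R := ((0, 0), true).

(** The exponent sum of v in a word of the extended generators; every phi^(q)
    preserves it, as it sends arcs to conjugates of a ([vexp_whom]). *)
Definition evexp (w : word egen) : int :=
  \sum_(l <- w) (if l.1 is None then sgb l.2 else 0).

Lemma vexp_whom q w : vexp (whom (phi K q) w) = evexp w.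
Proof.
have vphi x : vexp (phi K q x) = if x is None then 1 else 0.
  case: q x => [|[|q]] [j|]; rewrite /= ?vexp_cons ?vexp_nil //.
  by rewrite vexp_cat vexp_winv vexp_cons /= add0r addNr.
elim: w => [|[x b] w IH]; first by rewrite vexp_nil /evexp big_nil.
rewrite /whom /= vexp_cat -/(whom _ w) IH /evexp big_cons; congr (_ + _).
by case: b; rewrite ?vexp_winv vphi; case: x => //=; rewrite oppr0.
Qed.

Lemma evexp_cat u w : evexp (u ++ w) = evexp u + evexp w.
Proof. by rewrite /evexp big_cat. Qed.

Lemma fox_phi_arc (V : zmodType) (h : int -> V) q j :
  fox h (phi K q.+2 (Some j)) = h (evexp (lword K j)).
Proof. by rewrite -(vexp_whom q.+1) -fox_conj_a. Qed.

Lemma lwordS j : lword K j.+1 = lword K j ++ wgen K j.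
Proof. by rewrite /lword -addn1 iotaD map_cat flatten_cat /= cats0. Qed.

Lemma nth_classical j : (j < size P)%N -> (nth p0 P j).1 \in classical K.
Proof. by move=> jP; rewrite -mem_passages mem_nth. Qed.

Lemma evexp_wgen j : (j < size P)%N ->
  evexp (wgen K j) = - contrib R K (nth p0 P j).
Proof.
move=> jP; rewrite /wgen -/p0 /contrib.
have := csign_sgb R K _ (nth_classical j jP).
by case: (nth p0 P j).2; case: (0 < _) => ->; rewrite /evexp !big_cons big_nil.
Qed.

(** For an underpassage, the only letter other than v is the arc o; it comes
    last both in v o and in (o v)^-1 = v^-1 o^-1, so no v of w_j follows it. *)
Lemma fox_wgen (V : zmodType) (h : int -> V) q j : (j < size P)%N ->
  let p := nth p0 P j in
  fox h (whom (phi K q.+2) (wgen K j)) =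
  if p.2 then 0
  else h (evexp (lword K (index (p.1, true) P))) *~ csign K p.1.
Proof.
move=> jP /=; rewrite /wgen -/p0.
set o := index _ _; have := csign_sgb R K _ (nth_classical j jP).
have arc_v : vexp (phi K q.+2 (Some o)) = 0.
  have := vexp_whom q.+2 [:: (Some o, true)].
  by rewrite /whom /= cats0 /evexp big_seq1.
case: (nth p0 P j).2; case: (0 < _) => s_j; rewrite ?s_j.
- by rewrite /= addr0.
- by rewrite /= addr0.
- by rewrite /whom [flatten _]/= cats0 fox_cons add0r fox_phi_arc.
rewrite /whom /winv [flatten _]/= -/(winv (phi K q.+2 (Some o))).
rewrite cats0 fox_cons add0r -/(winv _) fox_winv arc_v mulrN1z.
by rewrite (eq_fox _ _ h) ?fox_phi_arc // => e; rewrite subr0.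
Qed.

(** The exponent sum of v to the right of w_j inside l_m is that of l_m minus
    that of l_j. *)
Lemma fox_lword (V : zmodType) (h : int -> V) q m : (m <= size P)%N ->
  fox h (whom (phi K q.+2) (lword K m)) =
  \sum_(0 <= j < m)
    let p := nth p0 P j in
    if p.2 then 0
    else h (evexp (lword K (index (p.1, true) P))
            + (evexp (lword K m) - evexp (lword K j.+1))) *~ csign K p.1.
Proof.
elim: m h => [|m IH] h mP; first by rewrite big_nil.
rewrite {1}lwordS whom_cat fox_cat vexp_whom IH ?fox_wgen ?(ltnW mP) //.
rewrite big_nat_recr //=.
rewrite subrr addr0; congr (_ + _); apply: eq_bigr => j _.
case: ifP => // _; rewrite (lwordS m) evexp_cat.
by congr (h _ *~ _); rewrite -!addrA [- _ + _]addrC.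
Qed.

Lemma evexp_lword j : (j <= size P)%N ->
  evexp (lword K j) = - \sum_(0 <= i < j) contrib R K (nth p0 P i).
Proof.
elim: j => [|j IH] jP; first by rewrite /evexp !big_nil oppr0.
by rewrite lwordS evexp_cat IH ?(ltnW jP) // evexp_wgen // big_nat_recr //= opprD.
Qed.

Lemma evexp_index p : p \in P ->
  evexp (lword K (index p P)) = - height R K (ptime K p).
Proof.
move=> pP; have iP : (index p P < size P)%N by rewrite index_mem.
by rewrite evexp_lword ?(ltnW iP) // -height_nth // nth_index.
Qed.

Lemma evexp_total : evexp (lword K (size P)) = 0.
Proof. by rewrite evexp_lword // -(big_nth p0 predT) contrib_total oppr0. Qed.

Lemma evexp_arcs w : all (fun l => isSome l.1) w -> evexp w = 0.
Proof.
elim: w => [|[[j|] b] w IH] //=; rewrite /evexp ?big_nil // big_cons add0r.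
exact: IH.
Qed.

(** Applied to the power of a_1 which closes the longitude. *)
Lemma fox_base_arc (V : zmodType) (h : int -> V) q w : h 0 = 0 ->
  all (fun l => l.1 == Some 0%N) w -> fox h (whom (phi K q.+2) w) = 0.
Proof.
move=> h0; elim: w => [|[x b] w IH] // /andP[/eqP x0 w0].
rewrite (_ : x = Some 0%N) // -(cat1s _ w) whom_cat fox_cat IH // addr0.
have w_arcs : all (fun l => isSome l.1) w by apply: sub_all w0 => l /eqP ->.
rewrite (eq_fox _ _ h) => [|e]; last by rewrite vexp_whom evexp_arcs ?addr0.
by case: b {x0}; rewrite /whom /= vexp_nil !addr0 h0 mul0rz.
Qed.

(** The letter contributed by a crossing c sees, to its right, the v-exponent
    of the word conjugating the arc o, and then minus the v-exponent of the
    portion of the longitude up to and including the underpassage: in terms of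
    heights this is [ind_height]. *)
Lemma fox_longitude (V : zmodType) (h : int -> V) q : h 0 = 0 ->
  fox h (longitude_ K q.+2) =
  \sum_(c <- classical K) h (ind K c) *~ csign K c.
Proof.
move=> h0; rewrite /longitude_ /longitude whom_cat fox_cat.
set tail := wpow _ _; have tail_arcs : all (fun l => l.1 == Some 0%N) tail.
  by rewrite /tail /wpow all_nseq eqxx orbT.
rewrite (fox_base_arc _ _ _ tail) //.
rewrite (eq_fox _ _ h) => [|e]; last first.
  rewrite vexp_whom evexp_arcs ?addr0 //.
  by apply: sub_all tail_arcs => l /eqP ->.
rewrite addr0 fox_lword // evexp_total.
pose G (p : passage R) := if p.2 then 0
  else h (evexp (lword K (index (p.1, true) P))
            - evexp (lword K (index p P).+1)) *~ csign K p.1.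
transitivity (\sum_(p <- P) G p).
  rewrite [RHS](big_nth p0); apply: eq_big_nat => j /andP[_ jP]; rewrite /G /=.
  by rewrite index_uniq ?passages_uniq // sub0r.
rewrite big_passages; apply: eq_big_seq => c cK; rewrite /G /= add0r.
have cP b : (c, b) \in P by rewrite mem_passages.
have iP : (index (c, false) P < size P)%N by rewrite index_mem.
rewrite lwordS evexp_cat evexp_wgen // nth_index // !evexp_index //.
rewrite ind_height // /contrib /ptime /=; congr (h _ *~ _).
by ring.
Qed.
End Longitude.

Theorem corollary6p1p3 (R : realType) (K : vdiagram R)
    (zh_eq0 : forall J : seq gen, J <> [::] -> zh K J = 0) :
  [/\ odd_writhe K = 0,
      henrich_turaev_poly K = 0,
      writhe_poly K = 0
    & affine_index_poly K = 0].
Proof.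
have moments j : \sum_(c <- classical K) binz (ind K c) j.+1 *~ csign K c = 0.
  rewrite -(fox_longitude _ _ _ (fun e => binz e j.+1) j.+1) ?binz0S //.
  rewrite -magnus_av.
  have := mu_eq0_of_zh R K zh_eq0 (ga :: nseq j.+1 gv); rewrite /mu eqxx.
  by rewrite [size _]/= size_nseq => ->.
have vanish := moments_fun _ _ _ _ moments.
split.
- rewrite /odd_writhe big_mkcond /=.
  rewrite -[RHS](vanish int (fun e => if odd `|e|%N then 1 else 0)) //.
  by apply: eq_bigr => c _; case: ifP; rewrite ?mul0rz // intz.
- rewrite /henrich_turaev_poly big_mkcond /=.
  rewrite -[RHS](vanish _ (fun e => if e != 0 then 'X^`|e|%N else 0)) ?eqxx //.
  by apply: eq_bigr => c _; case: ifP; rewrite ?mul0rz // -scaler_int intz.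
- rewrite /writhe_poly big_mkcond /=.
  rewrite -[RHS](vanish _ (fun e => if e != 0 then tvar ^ e else 0)) ?eqxx //.
  by apply: eq_bigr => c _; case: ifP; rewrite ?mul0rz // mulrC mulrzr.
- rewrite -[RHS](vanish _ (fun e => tvar ^ e - 1)) ?expr0z ?subrr //.
  by apply: eq_bigr => c _; rewrite mulrC mulrzr.
Qed.
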